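(* The complete multipartite graphs $K_{3,2,2}$ and $K_{2,2,2,1}$ have linkless embeddings in $\mathbb{R}^3$.
   Context: $K_{n_1,\dots,n_k}$ denotes the complete $k$-partite graph with parts of sizes $n_1,\dots,n_k$. An embedding means a tame embedding in $\mathbb{R}^3$. A link in an embedding is an unordered pair of vertex-disjoint cycles of the graph whose images form a non-trivial (non-split) two-component link; an embedding is linkless if it contains no link. *)

(* Defs.v *)
From HB Require Import structures.
From mathcomp Require Import all_boot all_order all_algebra.
From mathcomp Require Import all_classical all_reals all_analysis.

Set Implicit Arguments.
Unset Strict Implicit.
Unset Printing Implicit Defensive.

Import Order.TTheory GRing.Theory Num.Theory.
Import numFieldNormedType.Exports.

Local Open Scope classical_set_scope.
Local Open Scope ring_scope.

Record sgraph := SGraph {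
  vertex :> finType;
  adj : rel vertex;
  adj_sym : symmetric adj;
  adj_irr : irreflexive adj }.

(* A vertex of K_{n_1,...,n_k} is a pair (part, index within the part). *)
Section CompleteMultipartite.
Variable s : seq nat.

Definition multipartite_vertex : finType :=
  {i : 'I_(size s) & 'I_(nth 0%N s i)}.

Definition multipartite_adj : rel multipartite_vertex :=
  fun u v => tag u != tag v.

Lemma multipartite_adj_sym : symmetric multipartite_adj.
Proof. by move=> u v; rewrite /multipartite_adj eq_sym. Qed.

Lemma multipartite_adj_irr : irreflexive multipartite_adj.
Proof. by move=> u; rewrite /multipartite_adj eqxx. Qed.

Definition complete_multipartite : sgraph :=
  SGraph multipartite_adj_sym multipartite_adj_irr.

End CompleteMultipartite.

(* A cycle of length at least 3, listed in cyclic order; each cycle of the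
   graph is represented by all its rotations and reversals. *)
Definition graph_cycle (G : sgraph) (c : seq G) : Prop :=
  (2 < size c)%N /\ ucycle (@adj G) c.

Definition disjoint_cycles (G : sgraph) (c d : seq G) : Prop :=
  ~~ has (mem c) d.

Definition R3 (R : realType) := 'rV[R]_3.

Definition is_homeomorphism (T U : topologicalType) (h : T -> U) : Prop :=
  continuous h /\
  exists g : U -> T, [/\ continuous g, cancel h g & cancel g h].

Definition segment (R : realType) (p q : R3 R) : set (R3 R) :=
  [set (1 - t) *: p + t *: q | t in `[0, 1]].

(* [edge_arc u v] parametrizes the edge uv from u to v by [0, 1]; it is irrelevant
   when u and v are not adjacent, and everywhere outside [0, 1]. *)
Record embedding (R : realType) (G : sgraph) := Embedding {
  vertex_pos : G -> R3 R;
  edge_arc : G -> G -> R -> R3 R;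
  pos_inj : injective vertex_pos;
  arc_continuous : forall u v, adj u v ->
    {within `[0, 1], continuous (edge_arc u v)};
  arc_inj : forall u v, adj u v -> {in `[0, 1] &, injective (edge_arc u v)};
  arc_source : forall u v, adj u v -> edge_arc u v 0 = vertex_pos u;
  arc_target : forall u v, adj u v -> edge_arc u v 1 = vertex_pos v;
  arc_rev : forall u v, adj u v ->
    forall t, t \in `[0, 1] -> edge_arc v u t = edge_arc u v (1 - t);
  arc_avoids_vertices : forall u v w, adj u v ->
    forall t, t \in `]0, 1[ -> edge_arc u v t <> vertex_pos w;
  arc_avoids_arcs : forall u v u' v', adj u v -> adj u' v' ->
    (u', v') <> (u, v) -> (u', v') <> (v, u) ->
    forall t t', t \in `]0, 1[ -> t' \in `]0, 1[ ->
    edge_arc u v t <> edge_arc u' v' t' }.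

Section Links.
Variables (R : realType) (G : sgraph) (f : embedding R G).

Definition edge_image (u v : G) : set (R3 R) := edge_arc f u v @` `[0, 1].

Definition graph_image : set (R3 R) :=
  range (vertex_pos f) `|` \bigcup_(e in [set e : G * G | adj e.1 e.2])
    edge_image e.1 e.2.

(* Some homeomorphism of the ambient space carries the image of the graph to a
   one-dimensional polyhedron, that is, a finite union of (possibly degenerate)
   straight segments. *)
Definition tame : Prop :=
  exists2 h : R3 R -> R3 R, is_homeomorphism h &
  exists l : seq (R3 R * R3 R),
    h @` graph_image = \bigcup_(pq in [set` l]) segment pq.1 pq.2.

Definition cycle_image (c : seq G) : set (R3 R) :=
  \bigcup_(u in [set` c]) edge_image u (next c u).

End Links.

(* The Euclidean unit sphere (the library norm on row vectors is the sup
   norm, whose topology is the Euclidean one). *)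
Definition unit_sphere (R : realType) : set (R3 R) :=
  [set x : R3 R | \sum_i x 0 i ^+ 2 = 1].

Definition tame_sphere (R : realType) (S : set (R3 R)) : Prop :=
  exists2 h : R3 R -> R3 R, is_homeomorphism h &
    S = h @` @unit_sphere R.

(* A two-component link with components A and B is split if some sphere in its
   complement separates A from B. *)
Definition split_link (R : realType) (A B : set (R3 R)) : Prop :=
  exists S : set (R3 R),
    [/\ tame_sphere S, A `|` B `<=` ~` S &
        forall a b, A a -> B b -> ~ connected_component (~` S) a b].

(* The pair is unordered because the relation is symmetric in c and d. *)
Definition is_link (R : realType) (G : sgraph) (f : embedding R G)
    (c d : seq G) : Prop :=
  [/\ graph_cycle c, graph_cycle d, disjoint_cycles c d &
      ~ split_link (cycle_image f c) (cycle_image f d)].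

Definition linkless (R : realType) (G : sgraph) (f : embedding R G) : Prop :=
  ~ exists c d : seq G, is_link f c d.

Definition has_linkless_embedding (R : realType) (G : sgraph) : Prop :=
  exists f : embedding R G, tame f /\ linkless f.

(* Main.v *)
Require Import Defs.
From mathcomp Require Import all_boot all_order all_algebra.
From mathcomp Require Import all_classical all_reals all_analysis.
From mathcomp Require Import ring lra.

Set Implicit Arguments.
Unset Strict Implicit.
Unset Printing Implicit Defensive.

Import Order.TTheory GRing.Theory Num.Theory.
Import numFieldNormedType.Exports.

(** The vertices of both graphs are placed at the six vertices +-e_i of the
    regular octahedron and at its centre 0, and the edges are drawn as straight
    segments.  In K_{2,2,2,1} the centre is joined to all six other vertices;
    in K_{3,2,2} it belongs to the same part as +-e_1 and is joined to four.

    Two disjoint cycles have at most seven vertices together, so one of them is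
    a triangle.  Its flat disc is a face of the octahedron or the cone from the
    centre over an edge of the octahedron, and the other cycle misses it.  In
    fact every edge uv of the other cycle is strictly separated from the
    triangle xyz by a plane, whose normal is u + v - x - y - z: the nonzero
    vertices are unit vectors that are pairwise orthogonal or opposite, so a
    nonzero end of uv has height at least 1, a nonzero corner of the triangle
    has height at most -1, the centre has height 0, and it is not both an end
    and a corner ([octahedral_triangles]).  Two distinct edges are separated
    weakly by the plane whose normal is the difference of the sums of their
    endpoints, in which a common endpoint cancels, and likewise for an edge and
    a vertex; so the drawing is an embedding ([octahedral_cells]).  As the
    scalar products of the vertices are integers, both facts are finite
    computations.

    To split the two cycles, intersect a large cube around the triangle with
    the half-spaces given by the edges of the other cycle.  The result is a
    convex body with the triangle inside and the other cycle outside
    ([halfspaces_split]).  It is the unit ball of a gauge, a continuous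
    positively homogeneous function that vanishes only at the centre of the
    body, and rescaling every ray from that centre is a homeomorphism of the
    space that takes the round sphere to its boundary
    ([gauge_sphere_tame]). *)

Section LinklessEmbeddings.

Local Open Scope classical_set_scope.
Local Open Scope ring_scope.

(** * Spheres that are star-shaped about a point *)

Lemma sum_continuous (R : realType) (T : topologicalType) (I : finType)
    (F : I -> T -> R) :
  (forall i, continuous (F i)) -> continuous (fun x => \sum_i F i x).
Proof. by move=> Fc x; apply: (cvg_big add_continuous) => i _; exact: Fc. Qed.

Lemma shift_continuous (R : realType) (V : normedModType R) (c : V) :
  continuous (fun x => x - c).
Proof. by move=> x; apply: cvgB; [exact: cvg_id|exact: cvg_cst]. Qed.

Section Gauges.
Variable R : realType.
Implicit Types (N E : R3 R -> R) (x c : R3 R).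

(** The lower bound on N replaces compactness of the unit sphere: it gives
    both positivity away from 0 and continuity of rescaling at 0. *)
Definition gauge N : Prop :=
  [/\ continuous N, forall t x, 0 <= t -> N (t *: x) = t * N x &
      exists2 C, 0 < C & forall x, `|x| <= C * N x].

Lemma gauge0 N : gauge N -> N 0 = 0.
Proof. by case=> _ Nh _; rewrite -(scale0r 0) Nh// mul0r. Qed.

Lemma gauge_gt0 N x : gauge N -> x != 0 -> 0 < N x.
Proof.
case=> _ _ [C C0 NC] x0; rewrite -(pmulr_rgt0 _ C0).
by apply: lt_le_trans (NC x); rewrite normr_gt0.
Qed.

Lemma gauge_ge0 N x : gauge N -> 0 <= N x.
Proof.
move=> gN; have [->|x0] := eqVneq x 0; first by rewrite gauge0.
exact/ltW/gauge_gt0.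
Qed.

Definition radial E N x : R3 R := (E x / N x) *: x.

Lemma gauge_radial E N x : gauge E -> gauge N -> N (radial E N x) = E x.
Proof.
move=> gE gN; rewrite /radial; have [->|x0] := eqVneq x 0.
  by rewrite scaler0 !gauge0.
have [_ Nh _] := gN; rewrite Nh ?divr_ge0 ?gauge_ge0//.
by rewrite divfK ?gt_eqF ?gauge_gt0.
Qed.

Lemma radialK E N : gauge E -> gauge N -> cancel (radial E N) (radial N E).
Proof.
move=> gE gN x; rewrite {1}/radial gauge_radial//.
have [->|x0] := eqVneq x 0; first by rewrite /radial !scaler0.
have [Ex Nx] := (gauge_gt0 gE x0, gauge_gt0 gN x0).
have [_ Eh _] := gE; rewrite /radial Eh ?divr_ge0 ?gauge_ge0// scalerA.
rewrite [X in X *: _](_ : _ = 1) ?scale1r//.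
by field; rewrite !gt_eqF.
Qed.

(** Away from 0 the scaling factor is continuous.  At 0 it may have no limit,
    but |x| <= C * N x bounds the norm of the image by C * E x. *)
Lemma radial_continuous E N : gauge E -> gauge N -> continuous (radial E N).
Proof.
move=> gE gN x; have [[Ec _ _] [Nc _ [C C0 NC]]] := (gE, gN).
have [->|x0] := eqVneq x 0; last first.
  apply: (@continuousZ _ _ _ (fun x => E x / N x) id); last exact: cvg_id.
  apply: (@continuousM _ _ E (fun x => (N x)^-1)); first exact: Ec.
  by apply: continuousV; [rewrite gt_eqF// gauge_gt0|exact: Nc].
suff rad0 : radial E N y @[y --> (0 : R3 R)] --> (0 : R3 R).
  by rewrite /continuous_at [X in _ --> X]scaler0.
have CE0 : C * E y @[y --> (0 : R3 R)] --> (0 : R).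
  rewrite -(mulr0 C) -(gauge0 gE).
  by apply: (@continuousM _ _ (cst C) E); [exact: cst_continuous|exact: Ec].
suff : `|radial E N y| @[y --> (0 : R3 R)] --> (0 : R) by move/norm_cvg0P.
apply: (squeeze_cvgr _ (cvg_cst 0) CE0); near=> y.
rewrite normr_ge0 /= /radial normrZ ger0_norm ?divr_ge0 ?gauge_ge0//.
have [->|y0] := eqVneq y 0; first by rewrite normr0 mulr0 gauge0// mulr0.
have Ny := gauge_gt0 gN y0.
by rewrite mulrAC ler_pdivrMr// [leRHS]mulrAC [leRHS]mulrC ler_wpM2l ?gauge_ge0.
Unshelve. all: end_near. Qed.

Definition euclid x : R := Num.sqrt (\sum_i x 0 i ^+ 2).

Lemma normr_le_coord x (r : R) :
  0 <= r -> (forall i, `|x 0 i| <= r) -> `|x| <= r.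
Proof.
move=> r0 xr; rewrite [`|x|]mx_normrE.
apply/bigmax_leP; split=> //= -[i j] _ /=; by rewrite (ord1 i).
Qed.

Lemma euclid_gauge : gauge euclid.
Proof.
split.
- move=> x; apply: (@continuous_comp _ _ _ (fun x : R3 R => \sum_i x 0 i ^+ 2)
    (@Num.sqrt R)); last exact: sqrt_continuous.
  apply: sum_continuous => i {}x.
  apply: (@continuous_comp _ _ _ (fun y : R3 R => y 0 i) (fun r : R => r ^+ 2)).
    exact: coord_continuous.
  exact: exprn_continuous.
- move=> t x t0; rewrite /euclid.
  under eq_bigr => i _ do rewrite mxE exprMn.
  by rewrite -mulr_sumr sqrtrM ?sqr_ge0// sqrtr_sqr ger0_norm.
- exists 1 => // x; rewrite mul1r; apply: normr_le_coord => [|i].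
    exact: sqrtr_ge0.
  rewrite -sqrtr_sqr; apply: ler_wsqrtr.
  by rewrite (bigD1 i)//= lerDl sumr_ge0// => j _; exact: sqr_ge0.
Qed.

Lemma unit_sphereE : @unit_sphere R = [set x | euclid x = 1].
Proof.
apply/seteqP; split=> x; rewrite /unit_sphere /euclid /=.
  by move=> ->; rewrite sqrtr1.
move=> /(congr1 (fun y => y ^+ 2)); rewrite expr1n sqr_sqrtr//.
by apply: sumr_ge0 => i _; exact: sqr_ge0.
Qed.

(** The map c + radial euclid N rescales the rays from c so that the Euclidean
    length becomes the gauge. *)
Lemma gauge_sphere_tame N c :
  gauge N -> tame_sphere [set x | N (x - c) = 1].
Proof.
move=> gN; have gE := euclid_gauge.
exists (fun x => c + radial euclid N x).
- split=> [x|].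
    by apply: continuousD; [exact: cst_continuous|exact: radial_continuous].
  exists (fun x => radial N euclid (x - c)); split.
  + move=> x; apply: (@continuous_comp _ _ _ (fun x : R3 R => x - c)).
      exact: shift_continuous.
    exact: radial_continuous.
  + by move=> x; rewrite addrAC subrr add0r radialK.
  + by move=> x; rewrite radialK// addrC subrK.
- rewrite unit_sphereE; apply/seteqP; split=> [x /= Nx|_ [x /= Ex <-]].
    exists (radial N euclid (x - c)); first by rewrite /= gauge_radial.
    by rewrite radialK// addrC subrK.
  by rewrite addrAC subrr add0r gauge_radial.
Qed.

(** The image of a component under F is an interval; one that contains F a and
    F b contains r. *)
Lemma level_separates (T : topologicalType) (F : T -> R) (r : R) a b :
  continuous F -> F a < r -> r < F b ->
  ~ connected_component (~` [set x | F x = r]) a b.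
Proof.
move=> Fc Far rFb [D [Da sDr cD] Db].
have /connected_intervalP itv : connected (F @` D).
  by apply: connected_continuous_connected => //; exact: continuous_subspaceT.
have [x Dx Fx] : (F @` D) r.
  by apply: (itv (F a) (F b)); [exists a|exists b|rewrite !ltW].
exact: sDr Dx Fx.
Qed.

Lemma gauge_split N c (A B : set (R3 R)) : gauge N ->
  (forall a, A a -> N (a - c) < 1) -> (forall b, B b -> 1 < N (b - c)) ->
  split_link A B.
Proof.
move=> gN NA NB; exists [set x | N (x - c) = 1]; split.
- exact: gauge_sphere_tame.
- move=> x [/NA|/NB] Nx /= Nx1; by rewrite Nx1 ltxx in Nx.
- move=> a b /NA Na /NB Nb; apply: level_separates Na Nb => x.
  apply: (@continuous_comp _ _ _ (fun x : R3 R => x - c)).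
    exact: shift_continuous.
  by case: gN => + _ _; apply.
Qed.

Lemma split_link_sym (A B : set (R3 R)) : split_link A B -> split_link B A.
Proof.
move=> [S [tS sAB sep]]; exists S; split=> //; first by rewrite setUC.
by move=> b a Bb Aa /connected_component_sym; exact: sep.
Qed.

End Gauges.

(** * Convex bodies cut out by half-spaces *)

Section HalfSpaces.
Variable R : realType.
Implicit Types n x y : R3 R.

Definition dot x y : R := \sum_i x 0 i * y 0 i.

Lemma dotC x y : dot x y = dot y x.
Proof. by apply: eq_bigr => i _; rewrite mulrC. Qed.

Lemma dotDr n x y : dot n (x + y) = dot n x + dot n y.
Proof. by rewrite -big_split; apply: eq_bigr => i _; rewrite mxE mulrDr. Qed.

Lemma dotZr n t x : dot n (t *: x) = t * dot n x.
Proof. by rewrite mulr_sumr; apply: eq_bigr => i _; rewrite mxE mulrCA. Qed.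

Lemma dotBr n x y : dot n (x - y) = dot n x - dot n y.
Proof. by rewrite dotDr -scaleN1r dotZr mulN1r. Qed.

Lemma dot_continuous n : continuous (dot n).
Proof.
apply: sum_continuous => i x.
apply: (@continuousM _ _ (cst (n 0 i)) (fun x : R3 R => x 0 i)).
  exact: cst_continuous.
exact: coord_continuous.
Qed.

(** Since the norm is the sup norm, the unit ball of this gauge is a cube. *)
Lemma normr_gauge C : 0 < C -> gauge (fun x : R3 R => `|x| / C).
Proof.
move=> C0; split.
- move=> x; apply: (@continuousM _ _ (fun x : R3 R => `|x|) (cst C^-1)).
    exact: norm_continuous.
  exact: cst_continuous.
- by move=> t x t0; rewrite normrZ ger0_norm// mulrA.
- by exists C => // x; rewrite mulrC divfK// gt_eqF.
Qed.

(** Taking the maximum with a functional cuts the unit ball by the half-space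
    dot n x <= w when 0 < w.  The functional may be negative; the lower bound on
    the gauge comes from N alone. *)
Lemma max_gauge (N : R3 R -> R) n w :
  gauge N -> gauge (fun x => Num.max (dot n x / w) (N x)).
Proof.
case=> Nc Nh [C C0 NC]; split.
- move=> x; apply: (@continuous_max _ _ (fun x => dot n x / w) N x).
    apply: (@continuousM _ _ (dot n) (cst w^-1)); first exact: dot_continuous.
    exact: cst_continuous.
  exact: Nc.
- by move=> t x t0; rewrite dotZr Nh// -mulrA -maxr_pMr.
- by exists C => // x; rewrite (le_trans (NC x))// ler_pM2l// le_max lexx orbT.
Qed.

Lemma bigmax_gauge (N : R3 R -> R) (l : seq (R3 R * R)) (w : R3 R * R -> R) :
  gauge N -> gauge (fun x => \big[Num.max/N x]_(p <- l) (dot p.1 x / w p)).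
Proof.
move=> gN; elim: l => [|p l IH].
  by under eq_fun => x do rewrite big_nil.
by under eq_fun => x do rewrite big_cons; exact: max_gauge.
Qed.

(** The separating sphere bounds the cube of radius C about c cut by the
    half-spaces dot n x <= m, for (n, m) in l: since c is interior to each of
    them, the cut cube is the unit ball of a gauge centred at c. *)
Lemma halfspaces_split (A B : set (R3 R)) (c : R3 R) (C : R)
    (l : seq (R3 R * R)) :
  (forall a, A a -> `|a - c| < C) ->
  (forall p, p \in l -> dot p.1 c < p.2 /\ forall a, A a -> dot p.1 a < p.2) ->
  0 < C ->
  (forall b, B b -> exists2 p, p \in l & p.2 < dot p.1 b) ->
  split_link A B.
Proof.
move=> AC Al C0 Bl.
have w0 p : p \in l -> 0 < p.2 - dot p.1 c by move=> /Al[]; rewrite subr_gt0.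
apply: (gauge_split (c := c) (bigmax_gauge l (fun p => p.2 - dot p.1 c)
  (normr_gauge C0))).
- move=> a Aa; rewrite big_seq; apply: bigmax_lt => [|p pl].
    by rewrite ltr_pdivrMr// mul1r AC.
  have [_ /(_ _ Aa) pa] := Al _ pl.
  by rewrite ltr_pdivrMr ?w0// mul1r dotBr ltrD2r.
- move=> b /Bl[p pl pb].
  apply: (@lt_le_trans _ _ (dot p.1 (b - c) / (p.2 - dot p.1 c))).
    by rewrite ltr_pdivlMr ?w0// mul1r dotBr ltrD2r.
  exact: (bigmax_sup_seq _ p).
Qed.

End HalfSpaces.

(** * Straight-line drawings *)

Lemma convex_comb_ltl (R : realType) (a b m t : R) :
  0 <= t -> t <= 1 -> a < m -> b < m -> (1 - t) * a + t * b < m.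
Proof.
move=> t0 t1 am bm; apply: (@le_lt_trans _ _ (Num.max a b)); last first.
  by rewrite gt_max am.
rewrite -[leRHS]mul1r -[X in X * Num.max _ _](subrK t) [leRHS]mulrDl.
by apply: lerD; apply: ler_wpM2l; rewrite ?subr_ge0// le_max lexx ?orbT.
Qed.

Lemma convex_comb_gtr (R : realType) (a b m t : R) :
  0 <= t -> t <= 1 -> m < a -> m < b -> m < (1 - t) * a + t * b.
Proof.
move=> t0 t1 am bm; rewrite -ltrN2 opprD -!mulrN.
by apply: convex_comb_ltl => //; rewrite ltrN2.
Qed.

(** The strict inequality of the sums means that one of the two intervals
    spanned by a, b and by a', b' reaches strictly beyond their common boundary
    value, and then so does every proper convex combination. *)
Lemma convex_comb_lt (R : realType) (a b a' b' t t' : R) :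
  0 < t -> t < 1 -> 0 < t' -> t' < 1 ->
  a <= a' -> b <= a' -> a <= b' -> b <= b' -> a + b < a' + b' ->
  (1 - t) * a + t * b < (1 - t') * a' + t' * b'.
Proof.
move=> t0 t1 t0' t1' aa' ba' ab' bb' lt_ab.
pose m := Num.max a b; pose m' := Num.min a' b'.
have mm' : m <= m' by rewrite le_min !ge_max aa' ba' ab' bb'.
have : a <= m /\ b <= m by rewrite !le_max !lexx orbT.
have : m' <= a' /\ m' <= b' by rewrite !ge_min !lexx orbT.
move: m m' mm' => m m' mm' [ma' mb'] [am bm].
have [s0 s0'] : 0 < 1 - t /\ 0 < 1 - t' by split; lra.
have h1 : 0 <= (1 - t) * (m - a) by rewrite pmulr_rge0// subr_ge0.
have h2 : 0 <= t * (m - b) by rewrite pmulr_rge0// subr_ge0.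
have h3 : 0 <= (1 - t') * (a' - m') by rewrite pmulr_rge0// subr_ge0.
have h4 : 0 <= t' * (b' - m') by rewrite pmulr_rge0// subr_ge0.
rewrite ltNge; apply/negP => le_ba.
have : m - a <= 0 by rewrite -(pmulr_rle0 _ s0); lra.
have : m - b <= 0 by rewrite -(pmulr_rle0 _ t0); lra.
have : a' - m' <= 0 by rewrite -(pmulr_rle0 _ s0'); lra.
have : b' - m' <= 0 by rewrite -(pmulr_rle0 _ t0'); lra.
lra.
Qed.

Section StraightLine.
Variables (R : realType) (G : sgraph) (pos : G -> R3 R).

(** A vertex is treated as a degenerate edge, so that one separation
    condition covers injectivity on vertices, edges missing vertices and edges
    missing each other. *)
Definition cell (u v : G) := (u == v) || adj u v.

(** Cells may share a vertex, hence the weak inequalities; the strict one says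
    that they do not both lie in the separating plane, which is enough to make
    their relative interiors disjoint. *)
Definition cells_separated := forall u v u' v',
  cell u v -> cell u' v' -> (u', v') <> (u, v) -> (u', v') <> (v, u) ->
  exists n, (forall w w', w \in [:: u; v] -> w' \in [:: u'; v'] ->
      dot n (pos w) <= dot n (pos w')) /\
    dot n (pos u) + dot n (pos v) < dot n (pos u') + dot n (pos v').

Definition triangles_separated := forall x y z u v : G,
  adj x y -> adj y z -> adj z x -> adj u v ->
  u \notin [:: x; y; z] -> v \notin [:: x; y; z] ->
  exists n, forall w w', w \in [:: x; y; z] -> w' \in [:: u; v] ->
    dot n (pos w) < dot n (pos w').

Definition line (u v : G) (t : R) : R3 R := (1 - t) *: pos u + t *: pos v.

Lemma dot_line n u v t :
  dot n (line u v t) = (1 - t) * dot n (pos u) + t * dot n (pos v).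
Proof. by rewrite dotDr !dotZr. Qed.

Lemma line_continuous u v : continuous (line u v).
Proof.
rewrite /line => t; apply: cvgD; apply: cvgZr_tmp; last exact: cvg_id.
by apply: cvgB; [exact: cvg_cst|exact: cvg_id].
Qed.

Hypothesis cellsP : cells_separated.

Lemma lines_disjoint u v u' v' t t' :
  cell u v -> cell u' v' -> (u', v') <> (u, v) -> (u', v') <> (v, u) ->
  t \in `]0, 1[ -> t' \in `]0, 1[ -> line u v t <> line u' v' t'.
Proof.
move=> uv uv' d1 d2; rewrite !in_itv/= => /andP[t0 t1] /andP[t0' t1'].
have [n [le_n lt_n]] := cellsP uv uv' d1 d2.
have h1 := le_n u u' (mem_head _ _) (mem_head _ _).
have h2 := le_n v u' (mem_last _ [:: v]) (mem_head _ _).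
have h3 := le_n u v' (mem_head _ _) (mem_last _ [:: v']).
have h4 := le_n v v' (mem_last _ [:: v]) (mem_last _ [:: v']).
move=> /(congr1 (dot n)); rewrite !dot_line; apply/eqP; rewrite lt_eqF//.
exact: convex_comb_lt.
Qed.

Lemma straight_pos_inj : injective pos.
Proof.
move=> u w uw; apply: contrapT => nuw.
have [||||n [_]] := @cellsP u u w w; rewrite /cell ?eqxx//.
- by case=> wu _; apply: nuw.
- by case=> wu _; apply: nuw.
- by rewrite uw ltxx.
Qed.

Lemma line0 u v : line u v 0 = pos u.
Proof. by rewrite /line subr0 scale1r scale0r addr0. Qed.

Lemma line1 u v : line u v 1 = pos v.
Proof. by rewrite /line subrr scale1r scale0r add0r. Qed.

Lemma line_inj u v : adj u v -> injective (line u v).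
Proof.
move=> uv s t /eqP; rewrite -subr_eq0.
have -> : line u v s - line u v t = (s - t) *: (pos v - pos u).
  by apply/rowP => i; rewrite !mxE; ring.
rewrite scaler_eq0 !subr_eq0 => /orP[/eqP//|/eqP /straight_pos_inj vu].
by rewrite vu adj_irr in uv.
Qed.

Lemma line_rev u v t : line v u t = line u v (1 - t).
Proof. by rewrite /line subKr addrC. Qed.

Lemma line_avoids_vertices u v w t : adj u v -> t \in `]0, 1[ ->
  line u v t <> pos w.
Proof.
move=> uv t01.
(* The relative interior of the degenerate edge ww is its midpoint. *)
have -> : pos w = line w w 2^-1.
  by apply/rowP => i; rewrite !mxE; field.
have nuv : u <> v by move=> E; rewrite E adj_irr in uv.
apply: lines_disjoint => //; rewrite /cell ?uv ?orbT ?eqxx//.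
- by case=> e1 e2; apply: nuv; rewrite -e1 -e2.
- by case=> e1 e2; apply: nuv; rewrite -e1 -e2.
- by rewrite in_itv/=; apply/andP; split; lra.
Qed.

Definition straight_embedding : embedding R G.
Proof.
refine (@Embedding R G pos line straight_pos_inj _ _ _ _ _ _ _).
- by move=> u v _; exact/continuous_subspaceT/line_continuous.
- by move=> u v uv s t _ _; exact: line_inj.
- by move=> u v _; exact: line0.
- by move=> u v _; exact: line1.
- by move=> u v _ t _; exact: line_rev.
- by move=> u v w uv t; exact: line_avoids_vertices.
- move=> u v u' v' uv uv' d1 d2 t t'.
  by apply: lines_disjoint; rewrite /cell ?uv ?uv' ?orbT.
Defined.

Lemma straight_tame : tame straight_embedding.
Proof.
have id_cts : continuous (@id (R3 R)) by move=> x; exact: cvg_id.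
exists id; first by split=> //; exists id.
exists ([seq (pos u, pos u) | u <- enum G] ++
  [seq (pos e.1, pos e.2) | e <- enum {: G * G} & adj e.1 e.2]).
rewrite image_id; apply/seteqP; split=> x.
- case=> [[u _ <-]|[[u v] /= uv]].
    exists (pos u, pos u); first by rewrite /= mem_cat map_f ?mem_enum.
    exists 0; first by rewrite /= in_itv/= lexx ler01.
    by rewrite subr0 scale1r scale0r addr0.
  move=> uvx; exists (pos u, pos v) => //=; rewrite mem_cat; apply/orP; right.
  by apply/mapP; exists (u, v) => //; rewrite mem_filter mem_enum uv.
- case=> pq /=; rewrite mem_cat => /orP[/mapP[u _ ->]|/mapP[[u v]]].
    move=> [t _ <-]; left; exists u => //=.
    by rewrite -scalerDl subrK scale1r.
  rewrite mem_filter => /andP[/= uv _] -> uvx.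
  by right; exists (u, v).
Qed.

(** A half-space is needed for each edge of d only: the vertices of c and hence
    its edges lie on the other side of all of them. *)
Lemma separated_cycles_split (c d : seq G) : c != [::] ->
  (forall u, u \in d -> exists p : R3 R * R,
    [/\ forall w, w \in c -> dot p.1 (pos w) < p.2, p.2 < dot p.1 (pos u) &
        p.2 < dot p.1 (pos (next d u))]) ->
  split_link (cycle_image straight_embedding c)
    (cycle_image straight_embedding d).
Proof.
move=> c0 sep; have [u0 u0c] : exists u0, u0 \in c.
  by case: c c0 {sep} => // u0 c _; exists u0; rewrite mem_head.
have /choice[hs hsP] : forall u, exists p : R3 R * R, u \in d ->
    [/\ forall w, w \in c -> dot p.1 (pos w) < p.2, p.2 < dot p.1 (pos u) &
        p.2 < dot p.1 (pos (next d u))].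
  move=> u; case: (boolP (u \in d)) => [/sep[p ?]|_]; first by exists p.
  by exists (0, 0).
(* Each point of an edge has norm at most 2M, hence distance at most 3M from
   the centre pos u0. *)
pose M := \sum_w `|pos w|.
have posM w : `|pos w| <= M.
  by rewrite /M (bigD1 w)//= lerDl sumr_ge0.
have M0 : 0 <= M by exact: sumr_ge0.
apply: (@halfspaces_split _ _ _ (pos u0) (1 + (M + M + M)) (map hs d)).
- move=> a [u _ [t]]; rewrite /= in_itv/= => /andP[t0 t1] <-.
  apply: le_lt_trans (ler_normB _ _) _.
  suff : `|line u (next c u) t| <= M + M by have := posM u0; lra.
  apply: le_trans (ler_normD _ _) _; rewrite !normrZ.
  by apply: lerD; apply: le_trans (posM _); apply: ler_piMl => //;
    rewrite ger0_norm; lra.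
- move=> _ /mapP[u /hsP[cu _ _] ->]; split=> [|a]; first exact: cu.
  case=> v /= vc [t]; rewrite /= in_itv/= => /andP[t0 t1] <-.
  have h1 := cu _ vc; have h2 : dot (hs u).1 (pos (next c v)) < (hs u).2.
    by apply: cu; rewrite mem_next.
  by rewrite dot_line; exact: convex_comb_ltl.
- lra.
- move=> b [u /= ud [t]]; rewrite /= in_itv/= => /andP[t0 t1] <-.
  exists (hs u); first exact: map_f.
  by have [_ h1 h2] := hsP u ud; rewrite dot_line; exact: convex_comb_gtr.
Qed.

Hypothesis trianglesP : triangles_separated.

(** Any two vertices of c are adjacent, so [triangles_separated] applies to c
    and each edge of d; the plane is put halfway between the two. *)
Lemma triangle_split (c d : seq G) :
  graph_cycle c -> graph_cycle d -> disjoint_cycles c d -> (size c <= 3)%N ->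
  split_link (cycle_image straight_embedding c)
    (cycle_image straight_embedding d).
Proof.
move=> [c3 /andP[cc _]] [_ /andP[cd _]] /hasPn cd0 c3'.
apply: separated_cycles_split => [|u ud]; first by case: c c3 {cc cd0 c3'}.
have ud' := next_cycle cd ud; have vd : next d u \in d by rewrite mem_next.
move: (next d u) (cd0 _ ud) (cd0 _ vd) ud' => v; move: {cd0} c3 c3' cc.
case: c => [|x [|y [|z []]]] //= _ _ /and4P[xy yz zx _] uc vc uv.
have [n nP] := trianglesP xy yz zx uv uc vc.
pose T := Num.max (dot n (pos x)) (Num.max (dot n (pos y)) (dot n (pos z))).
pose E := Num.min (dot n (pos u)) (dot n (pos v)).
have TE : T < E.
  by rewrite /T /E !lt_min !gt_max !nP ?inE ?eqxx ?orbT.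
have [Tm mE] := midf_lt TE.
exists (n, (T + E) / 2); split=> [w wc||] /=.
- apply: le_lt_trans Tm.
  by move: wc; rewrite /T !inE !le_max => /or3P[] /eqP ->; rewrite lexx ?orbT.
- by apply: lt_le_trans mE _; rewrite /E ge_min lexx.
- by apply: lt_le_trans mE _; rewrite /E ge_min lexx orbT.
Qed.

(** Disjoint cycles with at most 7 vertices in total cannot both have length at
    least 4. *)
Lemma straight_linkless : (#|G| <= 7)%N -> linkless straight_embedding.
Proof.
move=> G7 [c [d [cc cd dcd]]]; apply.
have cd7 : (size c + size d <= 7)%N.
  have ucd : uniq (c ++ d).
    rewrite cat_uniq; have [[_ /andP[_ ->]] [_ /andP[_ ->]]] := (cc, cd).
    by rewrite andbT.
  by rewrite -size_cat -(card_uniqP ucd) (leq_trans (max_card _)).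
have [c3|c4] := leqP (size c) 3; first exact: triangle_split.
apply: split_link_sym; apply: triangle_split => //.
  by rewrite /disjoint_cycles has_sym.
by rewrite -(leq_add2l 4) (leq_trans _ cd7)// leq_add2r.
Qed.

End StraightLine.

(** * The octahedron with its centre *)

Definition codes (s : seq nat) : seq (nat * nat) :=
  [seq (i, j) | i <- iota 0 (size s), j <- iota 0 (nth 0%N s i)].

(** Vertices of K_s carry proofs that their indices are in range; pairs of
    natural numbers do not, which makes quantification over them computable. *)
Definition code s (v : multipartite_vertex s) : nat * nat :=
  (val (tag v), val (tagged v)).

Lemma code_mem s (v : multipartite_vertex s) : code v \in codes s.
Proof.
case: v => i j; apply/allpairsPdep; exists (val i), (val j).
by rewrite !mem_iota !add0n !ltn_ord.
Qed.

Lemma code_inj s : injective (@code s).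
Proof.
move=> [i j] [i' j'] [/val_inj ii']; case: _ / ii' j' => j' /val_inj jj'.
by rewrite jj'.
Qed.

Lemma card_multipartite s :
  (#|complete_multipartite s| <= size (codes s))%N.
Proof.
rewrite cardE -(size_map (@code s)); apply: uniq_leq_size.
  by rewrite (map_inj_uniq (@code_inj s)) enum_uniq.
by move=> _ /mapP[v _ ->]; exact: code_mem.
Qed.

Definition adjc (a b : nat * nat) := a.1 != b.1.

(** Vertex (i, j) is placed at charge (i, j) times e_i: indices 0 and 1 of the
    first three parts give e_i and -e_i, and any other vertex is the centre. *)
Definition charge (a : nat * nat) : int :=
  if (a.1 < 3)%N then nth 0 [:: 1; -1] a.2 else 0.

Definition gram (a b : nat * nat) : int :=
  if a.1 == b.1 then charge a * charge b else 0.

(** The scalar product of w with the difference of the sums of the points of s'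
    and s ([dot_separator]), written with foldr because big operators are locked
    and do not compute. *)
Definition height (s s' : seq (nat * nat)) (w : nat * nat) : int :=
  foldr +%R 0 [seq gram b w | b <- s'] - foldr +%R 0 [seq gram a w | a <- s].

(** Conditionals rather than boolean implications, so that evaluation skips the
    tuples that do not satisfy the premises. *)
Definition check_cells (c : seq (nat * nat)) : bool :=
  all (fun u => all (fun v => if (u == v) || adjc u v then
    all (fun u' => all (fun v' => if [&& (u' == v') || adjc u' v',
        (u', v') != (u, v) & (u', v') != (v, u)] then
      let h := height [:: u; v] [:: u'; v'] in
      all (fun w => all (fun w' => h w <= h w') [:: u'; v']) [:: u; v] &&
      (h u + h v < h u' + h v')
    else true) c) c else true) c) c.

Definition check_triangles (c : seq (nat * nat)) : bool :=
  all (fun x => all (fun y => if adjc x y then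
    all (fun z => if adjc y z && adjc z x then
      all (fun u => if u \notin [:: x; y; z] then
        all (fun v => if adjc u v && (v \notin [:: x; y; z]) then
          let h := height [:: x; y; z] [:: u; v] in
          all (fun w => all (fun w' => h w < h w') [:: u; v]) [:: x; y; z]
        else true) c else true) c else true) c else true) c) c.

Section Octahedral.
Variables (R : realType) (s : seq nat).
Let G := complete_multipartite s.

Definition octahedral_pos (v : G) : R3 R :=
  (charge (code v))%:~R *: delta_mx 0 (inord (code v).1).

Lemma dot_pos (u v : G) :
  dot (octahedral_pos u) (octahedral_pos v) = (gram (code u) (code v))%:~R.
Proof.
rewrite /octahedral_pos dotZr dotC dotZr.
have -> (i j : 'I_3) : dot (delta_mx 0 i) (delta_mx 0 j) = (i == j)%:R :> R.
  rewrite /dot (bigD1 i)//= big1 ?addr0 => [|k /negPf ki].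
    by rewrite !mxE !eqxx mul1r.
  by rewrite !mxE ki mul0r.
rewrite /gram; case: ifPn => [/eqP ->|uv].
  by rewrite eqxx mulr1 intrM mulrC.
(* The cast inord to 'I_3 is injective on parts of nonzero charge only. *)
rewrite /charge; case: ltnP => v3; last by rewrite mul0r.
case: ltnP => u3; last by rewrite mul0r mulr0.
suff /negbTE -> : inord (code v).1 != inord (code u).1 :> 'I_3.
  by rewrite mulr0n !mulr0.
by apply: contra uv => /eqP/(congr1 val) /=; rewrite !inordK// => ->.
Qed.

Definition separator (s1 s2 : seq G) : R3 R :=
  \sum_(v <- s2) octahedral_pos v - \sum_(u <- s1) octahedral_pos u.

Lemma dot_separator s1 s2 w : dot (separator s1 s2) (octahedral_pos w) =
  (height (map (@code s) s1) (map (@code s) s2) (code w))%:~R.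
Proof.
rewrite dotC dotBr /height intrB !foldrE -!map_comp !big_map.
have dot_sum r : dot (octahedral_pos w) (\sum_(v <- r) octahedral_pos v) =
    (\sum_(v <- r) gram (code v) (code w))%:~R.
  elim: r => [|v r IH]; last by rewrite !big_cons dotDr IH intrD dotC dot_pos.
  by rewrite !big_nil -(scale0r 0) dotZr mul0r.
by rewrite !dot_sum.
Qed.

Lemma octahedral_cells :
  check_cells (codes s) -> cells_separated octahedral_pos.
Proof.
have inc v := @code_mem s v.
move=> chk u v u' v' uv uv' d1 d2; exists (separator [:: u; v] [:: u'; v']).
have cellE (a b : G) : cell a b = (code a == code b) || adjc (code a) (code b).
  by rewrite /cell (inj_eq (@code_inj s)).
have pairE (a b a' b' : G) : (a', b') <> (a, b) ->
    (code a', code b') != (code a, code b).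
  move=> d; apply/negP; rewrite xpair_eqE !(inj_eq (@code_inj s)).
  by move=> /andP[/eqP a'a /eqP b'b]; apply: d; rewrite a'a b'b.
move: chk => /allP/(_ _ (inc u))/allP/(_ _ (inc v)); rewrite -cellE uv.
move=> /allP/(_ _ (inc u'))/allP/(_ _ (inc v')); rewrite -cellE uv' !pairE//.
set h := height _ _ => /andP[/allP hP lt_h].
split=> [w w' wE wE'|]; last by rewrite !dot_separator -!intrD ltr_int.
rewrite !dot_separator ler_int; apply: (allP (hP _ _)).
  exact: (map_f (@code s) wE).
exact: (map_f (@code s) wE').
Qed.

Lemma octahedral_triangles :
  check_triangles (codes s) -> triangles_separated octahedral_pos.
Proof.
have inc v := @code_mem s v.
move=> chk x y z u v xy yz zx uv uT vT.
exists (separator [:: x; y; z] [:: u; v]).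
have notinE (w : G) : w \notin [:: x; y; z] ->
    code w \notin [:: code x; code y; code z].
  by rewrite !inE !(inj_eq (@code_inj s)).
have adjE (a b : G) : adj a b = adjc (code a) (code b) by [].
move: chk => /allP/(_ _ (inc x))/allP/(_ _ (inc y)); rewrite -adjE xy.
move=> /allP/(_ _ (inc z)); rewrite -!adjE yz zx.
move=> /allP/(_ _ (inc u)); rewrite (notinE _ uT).
move=> /allP/(_ _ (inc v)); rewrite (notinE _ vT) -adjE uv.
set h := height _ _ => /allP hP w w' wT wE.
rewrite !dot_separator ltr_int.
apply: (allP (hP _ _)); last exact: map_f wE.
exact: (map_f (@code s) wT).
Qed.

End Octahedral.

End LinklessEmbeddings.

Theorem proposition3 (R : realType) :
  has_linkless_embedding R (complete_multipartite [:: 3; 2; 2]) /\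
  has_linkless_embedding R (complete_multipartite [:: 2; 2; 2; 1]).
Proof.
have octahedral s : (size (codes s) <= 7)%N -> check_cells (codes s) ->
    check_triangles (codes s) ->
    has_linkless_embedding R (complete_multipartite s).
  move=> s7 /(octahedral_cells R) cP /(octahedral_triangles R) tP.
  exists (straight_embedding cP); split; first exact: straight_tame.
  apply: straight_linkless => //; apply: leq_trans s7.
  exact: card_multipartite.
by split; apply: octahedral; vm_compute.
Qed.
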